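(* Let $A\in\mathbb{R}^{m\times n}$ and $b\in\mathbb{R}^m$ be such that $Ax=b$ is solvable, and let $p>0$, $0<q\le 1$. Let the sequence $(x^k)_{k\ge 1}$ in $\mathbb{R}^n$ be generated by: $x^1$ is a solution of $\min\{\|x\|_1: Ax=b\}$, and $$x^{k+1}=F(x^k)A^T\left(AF(x^k)A^T\right)^{\dagger}b\qquad(k\ge 1).$$ Then $\|x^{k+1}\|_{h_{p,q}}\le\|x^k\|_{h_{p,q}}$ for all $k\ge 1$, and every limit point $x^*$ of the sequence $(x^k)$ satisfies $$x^*=F(x^* )A^T\left(AF(x^* )A^T\right)^{\dagger}b .$$
   Context: For $p>0$ and $0<q\le 1$ let $h_{p,q}(t)=\log\left(1+|t|^q/p\right)$ for $t\in\mathbb{R}$, and for $x\in\mathbb{R}^n$ let $\|x\|_{h_{p,q}}=\sum_{i=1}^n h_{p,q}(x_i)$. For $x\in\mathbb{R}^n$, $F(x)\in\mathbb{R}^{n\times n}$ is the diagonal matrix with entries $F(x)_{i,i}=\dfrac{|x_i|^{2-q}\left(p+|x_i|^q\right)}{q}$. $M^\dagger$ denotes the Moore–Penrose pseudoinverse of $M$. *)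

(* Defs.v *)
From mathcomp Require Import all_boot all_order all_algebra.
From mathcomp Require Import all_classical all_reals all_analysis.

Set Implicit Arguments.
Unset Strict Implicit.
Unset Printing Implicit Defensive.

Import Order.TTheory GRing.Theory Num.Theory.
Import numFieldNormedType.Exports.

Local Open Scope ring_scope.
Local Open Scope classical_set_scope.

Definition is_mp_inverse {R : realType} {m n : nat}
    (M : 'M[R]_(m, n)) (P : 'M[R]_(n, m)) : Prop :=
  [/\ M *m P *m M = M, P *m M *m P = P,
      (M *m P)^T = M *m P & (P *m M)^T = P *m M].

Lemma mulmx_tr_eq0 {R : realType} {m n : nat} (B : 'M[R]_(m, n)) :
  B *m B^T = 0 -> B = 0.
Proof.
move=> /matrixP BB0; apply/matrixP => i j; rewrite mxE.
have := BB0 i i; rewrite !mxE => /eqP.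
under eq_bigr do rewrite mxE -expr2.
rewrite psumr_eq0; last by move=> k _; exact: sqr_ge0.
by move=> /allP /(_ j (mem_index_enum _)); rewrite sqrf_eq0 => /eqP.
Qed.

Lemma row_free_gram_unit {R : realType} {m n : nat} (B : 'M[R]_(m, n)) :
  row_free B -> B *m B^T \in unitmx.
Proof.
move=> freeB; rewrite -row_free_unit -kermx_eq0; apply/eqP.
apply: (row_free_inj freeB); rewrite mul0mx; apply: mulmx_tr_eq0.
by rewrite trmx_mul mulmxA -(mulmxA _ B) mulmx_ker mul0mx.
Qed.

Lemma mp_inverse_exists {R : realType} {m n : nat} (M : 'M[R]_(m, n)) :
  exists P : 'M[R]_(n, m), is_mp_inverse M P.
Proof.
have [r [C [B [MCB freeB fullC]]]] :
    exists r (C : 'M[R]_(m, r)) (B : 'M[R]_(r, n)),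
      [/\ M = C *m B, row_free B & row_full C].
  exists (\rank M), (col_base M), (row_base M).
  by rewrite mulmx_base row_base_free col_base_full.
have uB : B *m B^T \in unitmx.
  exact: row_free_gram_unit.
have uC : C^T *m C \in unitmx.
  rewrite -{2}(trmxK C); apply: row_free_gram_unit.
  by rewrite /row_free mxrank_tr.
have sB : (invmx (B *m B^T))^T = invmx (B *m B^T).
  by rewrite trmx_inv trmx_mul trmxK.
have sC : (invmx (C^T *m C))^T = invmx (C^T *m C).
  by rewrite trmx_inv trmx_mul trmxK.
pose P := B^T *m invmx (B *m B^T) *m (invmx (C^T *m C) *m C^T).
have MP : M *m P = C *m invmx (C^T *m C) *m C^T.
  rewrite MCB /P -!mulmxA (mulmxA B) (mulmxA (B *m B^T)) mulmxV //.
  by rewrite mul1mx.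
have PM : P *m M = B^T *m invmx (B *m B^T) *m B.
  rewrite MCB /P -!mulmxA (mulmxA C^T) (mulmxA (invmx (C^T *m C))) mulVmx //.
  by rewrite mul1mx.
exists P; split.
- by rewrite MP MCB -!mulmxA (mulmxA C^T) (mulmxA (invmx (C^T *m C))) mulVmx ?mul1mx.
- rewrite PM /P -!mulmxA (mulmxA B B^T) (mulmxA (B *m B^T)) mulmxV //.
  by rewrite mul1mx.
- by rewrite MP !trmx_mul trmxK sC mulmxA.
- by rewrite PM !trmx_mul trmxK sB mulmxA.
Qed.

Lemma mp_inverse_unique {R : realType} {m n : nat} (M : 'M[R]_(m, n))
    (P Q : 'M[R]_(n, m)) :
  is_mp_inverse M P -> is_mp_inverse M Q -> P = Q.
Proof.
move=> [P1 P2 P3 P4] [Q1 Q2 Q3 Q4].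
have eL : M *m P = M *m Q.
  rewrite -P3 -{1}Q1 -(mulmxA (M *m Q)) trmx_mul P3 Q3.
  by rewrite mulmxA P1.
have eR : P *m M = Q *m M.
  rewrite -P4 -{1}Q1 -mulmxA mulmxA trmx_mul P4 Q4.
  by rewrite -(mulmxA Q) (mulmxA M) P1.
by rewrite -P2 -Q2 eR -!mulmxA eL.
Qed.

(* The Moore-Penrose pseudoinverse, i.e., the unique solution of the four
   Penrose equations; not to be confused with [pinvmx], which is only a
   generalized inverse. *)
Definition mp_pinv {R : realType} {m n : nat} (M : 'M[R]_(m, n)) :
    'M[R]_(n, m) :=
  xget 0 [set P | is_mp_inverse M P].

Lemma mp_pinvP {R : realType} {m n : nat} (M : 'M[R]_(m, n)) :
  is_mp_inverse M (mp_pinv M).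
Proof.
rewrite /mp_pinv; case: xgetP => // noP.
by have [P MP] := mp_inverse_exists M; have := noP P MP.
Qed.

Definition norm1 {R : realType} {n : nat} (x : 'cV[R]_n) : R :=
  \sum_(i < n) `|x i 0|.

(* Since 0 `^ a = 0 for a != 0, the real powers of `|t| below have their usual
   value at t = 0 when 0 < q <= 1; in particular, [Fmx p q x] has a zero
   diagonal entry wherever x vanishes. *)
Definition hpq {R : realType} (p q t : R) : R := ln (1 + `|t| `^ q / p).

Definition norm_hpq {R : realType} {n : nat} (p q : R) (x : 'cV[R]_n) : R :=
  \sum_(i < n) hpq p q (x i 0).

Definition Fmx {R : realType} {n : nat} (p q : R) (x : 'cV[R]_n) : 'M[R]_n :=
  diag_mx (\row_i (`|x i 0| `^ (2 - q) * (p + `|x i 0| `^ q) / q)).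

Definition l1_solution {R : realType} {m n : nat} (A : 'M[R]_(m, n))
    (b : 'cV[R]_m) (x : 'cV[R]_n) : Prop :=
  A *m x = b /\ forall y : 'cV[R]_n, A *m y = b -> norm1 x <= norm1 y.

Definition reweighted_step {R : realType} {m n : nat} (p q : R)
    (A : 'M[R]_(m, n)) (b : 'cV[R]_m) (x : 'cV[R]_n) : 'cV[R]_n :=
  Fmx p q x *m A^T *m mp_pinv (A *m Fmx p q x *m A^T) *m b.

(* Main.v *)
(* Up to the factor 1/2, the reciprocals of the diagonal entries of [F x] are
   the derivatives of [log (1 + s^(q/2) / p)] at [s = x_i^2]. This function of [s]
   is concave, so a step [x -> y], which minimizes the quadratic form
   [sum_i y_i^2 / F(x)_ii] over the feasible vectors supported in the support of
   [x], decreases the objective by at least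
   [1/2 sum_i (x_i - y_i)^2 / F(x)_ii]. These decreases are summable, so the
   successors of iterates close to a limit point x* also approach x*. The
   pseudoinverse need not be continuous at x*, where the support may shrink.
   Instead, one passes to the limit in the optimality conditions
   [sum_i y_i z_i / F(x)_ii = 0] for [z] in the kernel of [A] supported in the
   support of x*, a set contained in the support of every iterate close to x*;
   they determine the step taken from x*. *)
Require Import Defs.
From mathcomp Require Import all_boot all_order all_algebra.
From mathcomp Require Import all_classical all_reals all_analysis.
From mathcomp Require Import ring lra.

Set Implicit Arguments.
Unset Strict Implicit.

Import Order.TTheory GRing.Theory Num.Theory.
Import numFieldNormedType.Exports.

Local Open Scope ring_scope.
Local Open Scope classical_set_scope.

(** * Weighted least squares through the pseudoinverse *)

Lemma mul_mp_pinv_factor (R : realType) (m n : nat) (B : 'M[R]_(m, n)) :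
  B *m B^T *m mp_pinv (B *m B^T) *m B = B.
Proof.
have [MPM _ _ _] := mp_pinvP (B *m B^T); apply/eqP; rewrite -subr_eq0.
apply/eqP; apply: mulmx_tr_eq0; set M := B *m B^T in MPM *.
(* By the first Penrose equation the defect G kills [B^T]; since [G^T] is [B^T] times a matrix, also
   [G *m G^T = 0]. *)
have GB : (M *m mp_pinv M *m B - B) *m B^T = 0.
  by rewrite mulmxBl -(mulmxA (M *m _)) -/M MPM subrr.
by rewrite linearB /= trmx_mul mulmxBr mulmxA GB mul0mx subrr.
Qed.

(** For [d >= 0], this minimizes the sum of [y_j^2 / d_j] over the solutions of [A y = b] supported
    in the support of [d], if there are any. *)
Definition weighted_solution {R : realType} {m n : nat} (d : 'rV[R]_n)
    (A : 'M[R]_(m, n)) (b : 'cV[R]_m) : 'cV[R]_n :=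
  diag_mx d *m A^T *m mp_pinv (A *m diag_mx d *m A^T) *m b.

Lemma weighted_solution_supp (R : realType) (m n : nat) (d : 'rV[R]_n)
    (A : 'M[R]_(m, n)) (b : 'cV[R]_m) (j : 'I_n) :
  d 0 j = 0 -> weighted_solution d A b j 0 = 0.
Proof.
by move=> dj0; rewrite /weighted_solution -!mulmxA mul_diag_mx mxE dj0 mul0r.
Qed.

(** With S the square root of [diag_mx d] and [B = A S], the support condition gives [x = S u], so
    [A x = B u] lies in the range of [B], which [mul_mp_pinv_factor] shows to be fixed. *)
Lemma weighted_solution_feasible (R : realType) (m n : nat) (d : 'rV[R]_n)
    (A : 'M[R]_(m, n)) (x : 'cV[R]_n) :
  (forall j, 0 <= d 0 j) -> (forall j, d 0 j = 0 -> x j 0 = 0) ->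
  A *m weighted_solution d A (A *m x) = A *m x.
Proof.
move=> d_ge0 supp_x.
pose s := \row_j Num.sqrt (d 0 j); pose u := \col_j (x j 0 / s 0 j).
have sE j : s 0 j ^+ 2 = d 0 j by rewrite mxE sqr_sqrtr.
have dE : diag_mx d = diag_mx s *m diag_mx s.
  by rewrite mulmx_diag; congr diag_mx; apply/rowP => j;
    rewrite [RHS]mxE -expr2 sE.
have xE : x = diag_mx s *m u.
  apply/colP => j; rewrite mul_diag_mx [RHS]mxE [X in _ * X]mxE.
  have [sj0|sj0] := eqVneq (s 0 j) 0; last by rewrite mulrC divfK.
  by rewrite supp_x ?mul0r ?mulr0 // -sE sj0 expr0n.
pose B := A *m diag_mx s.
have AdA : A *m diag_mx d *m A^T = B *m B^T.
  by rewrite dE /B trmx_mul tr_diag_mx !mulmxA.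
rewrite /weighted_solution !mulmxA AdA [in LHS]xE [in RHS]xE !mulmxA -/B.
by rewrite -(mulmxA _ A (diag_mx s)) mul_mp_pinv_factor.
Qed.

(** Makes the residual an admissible test vector in the orthogonality relation. *)
Lemma weighted_solution_residual (R : realType) (m n : nat) (d : 'rV[R]_n)
    (A : 'M[R]_(m, n)) (x : 'cV[R]_n)
    (z := x - weighted_solution d A (A *m x)) :
  (forall j, 0 <= d 0 j) -> (forall j, d 0 j = 0 -> x j 0 = 0) ->
  (forall j, d 0 j = 0 -> z j 0 = 0) /\ A *m z = 0.
Proof.
move=> d_ge0 supp_x; split => [j dj0|].
  by rewrite /z mxE [X in _ + X]mxE supp_x // weighted_solution_supp // subrr.
by rewrite /z mulmxBr weighted_solution_feasible // subrr.
Qed.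

(* [0^-1 = 0], so the sum only runs over the support of [d]. *)
Lemma weighted_solution_orthogonal (R : realType) (m n : nat) (d : 'rV[R]_n)
    (A : 'M[R]_(m, n)) (b : 'cV[R]_m) (z : 'cV[R]_n) :
  (forall j, d 0 j = 0 -> z j 0 = 0) -> A *m z = 0 ->
  \sum_j weighted_solution d A b j 0 * z j 0 / d 0 j = 0.
Proof.
move=> supp_z Az0; rewrite /weighted_solution -!mulmxA.
set l := mp_pinv _ *m b.
transitivity ((z^T *m (A^T *m l)) 0 0).
  rewrite [RHS]mxE; apply: eq_bigr => j _; rewrite mul_diag_mx !mxE.
  have [dj0|dj0] := eqVneq (d 0 j) 0; first by rewrite supp_z ?mulr0 ?mul0r.
  by field.
by rewrite mulmxA -trmx_mul Az0 trmx0 mul0mx mxE.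
Qed.

(** Testing the relations for [x] and for the weighted solution [y] with [x - y] and subtracting
    makes the weighted norm of [x - y] vanish. *)
Lemma weighted_solution_unique (R : realType) (m n : nat) (d : 'rV[R]_n)
    (A : 'M[R]_(m, n)) (x : 'cV[R]_n) :
  (forall j, 0 <= d 0 j) -> (forall j, d 0 j = 0 -> x j 0 = 0) ->
  (forall z : 'cV[R]_n, (forall j, d 0 j = 0 -> z j 0 = 0) -> A *m z = 0 ->
    \sum_j x j 0 * z j 0 / d 0 j = 0) ->
  x = weighted_solution d A (A *m x).
Proof.
move=> d_ge0 supp_x orth_x; set y := weighted_solution _ _ _.
have [supp_z Az0] := weighted_solution_residual A d_ge0 supp_x.
have : \sum_j (x - y) j 0 ^+ 2 / d 0 j = 0.
  have orth : \sum_j x j 0 * (x - y) j 0 / d 0 j -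
      \sum_j y j 0 * (x - y) j 0 / d 0 j = 0.
    by rewrite orth_x // weighted_solution_orthogonal // subrr.
  rewrite -[RHS]orth -sumrB.
  by apply: eq_bigr => j _; rewrite !mxE; ring.
move=> /eqP; rewrite psumr_eq0 => [/allP z0|j _]; last first.
  by rewrite divr_ge0 ?sqr_ge0.
apply/eqP; rewrite -subr_eq0; apply/eqP/colP => j; rewrite [RHS]mxE.
have [/supp_z //|dj0] := eqVneq (d 0 j) 0.
have := z0 j (mem_index_enum _).
by rewrite mulf_eq0 invr_eq0 (negPf dj0) orbF sqrf_eq0 => /eqP.
Qed.

(** In [x^2 - y^2 = (x - y)^2 + 2 y (x - y)] the cross terms sum to 0 by orthogonality. *)
Lemma weighted_solution_pythagoras (R : realType) (m n : nat) (d : 'rV[R]_n)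
    (A : 'M[R]_(m, n)) (x : 'cV[R]_n) (y := weighted_solution d A (A *m x)) :
  (forall j, 0 <= d 0 j) -> (forall j, d 0 j = 0 -> x j 0 = 0) ->
  \sum_j (x j 0 ^+ 2 - y j 0 ^+ 2) / d 0 j =
  \sum_j (x j 0 - y j 0) ^+ 2 / d 0 j.
Proof.
move=> d_ge0 supp_x.
have [supp_z Az0] := weighted_solution_residual A d_ge0 supp_x.
have := weighted_solution_orthogonal (A *m x) supp_z Az0.
rewrite -/y => orth; apply/eqP; rewrite -subr_eq0 -sumrB; apply/eqP.
rewrite -[RHS](mulr0 2) -{2}orth mulr_sumr; apply: eq_bigr => j _.
by rewrite !mxE; ring.
Qed.

(** * Concavity of the penalty in the squared variable *)

Lemma powR_bernoulli (R : realType) (s t : R) :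
  0 < s <= 1 -> 0 <= t -> t `^ s <= 1 - s + s * t.
Proof.
move=> /andP[s0 s1]; rewrite le_eqVlt => /predU1P[<-|t0].
  by rewrite powR0 ?gt_eqF // mulr0 addr0 subr_ge0.
have c0 : 0 < t `^ s by exact: powR_gt0.
(* Both bounds are [exp v >= 1 + v]. Weighted by [1 - s] and [s], their logarithms cancel, leaving
   the claim divided by the power of [t]. *)
have e1 : (t `^ s)^-1 >= 1 - s * ln t.
  by rewrite -powRN /powR gt_eqF // -mulNr expR_ge1Dx.
have e2 : t / t `^ s >= 1 + (1 - s) * ln t.
  have -> : t / t `^ s = t `^ (1 - s).
    by rewrite powRB ?powRr1 ?ltW // (gt_eqF t0) implybT.
  by rewrite /powR gt_eqF // expR_ge1Dx.
rewrite -(ler_pM2r (x := (t `^ s)^-1)) ?invr_gt0 // divff ?gt_eqF //.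
have e3 := ler_wpM2l (ltW s0) e2.
have e4 : (1 - s) * (1 - s * ln t) <= (1 - s) * (t `^ s)^-1.
  by rewrite ler_wpM2l // subr_ge0.
rewrite mulrDl -mulrA; apply: le_trans (lerD e4 e3).
by rewrite le_eqVlt; apply/orP; left; apply/eqP; ring.
Qed.

(** Kept literally equal to the diagonal entry of [Fmx], so that [reweighted_stepE] holds by
    conversion. *)
Definition hweight {R : realType} (p q t : R) : R :=
  `|t| `^ (2 - q) * (p + `|t| `^ q) / q.

Lemma hweight_gt0 (R : realType) (p q t : R) :
  0 < p -> 0 < q -> t != 0 -> 0 < hweight p q t.
Proof.
move=> p0 q0 t0; rewrite divr_gt0 // mulr_gt0 ?powR_gt0 ?normr_gt0 //.
by rewrite ltr_wpDr ?powR_ge0.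
Qed.

Lemma hweight0 (R : realType) (p q : R) : q <= 1 -> hweight p q 0 = 0.
Proof.
move=> q1; rewrite /hweight normr0 powR0 ?mul0r //.
by rewrite subr_eq0 gt_eqF // (le_lt_trans q1) // ltr1n.
Qed.

(* As a function of [t ^+ 2], [hpq] is concave with slope
   [1 / (2 * hweight t)]. *)
Lemma hpq_tangent (R : realType) (p q t u : R) :
  0 < p -> 0 < q -> q <= 1 -> t != 0 ->
  hpq p q u - hpq p q t <= (u ^+ 2 - t ^+ 2) / (2 * hweight p q t).
Proof.
move=> p0 q0 q1 t0; have a0 : 0 < `|t| by rewrite normr_gt0.
have Q0 : 0 < p + `|t| `^ q by rewrite ltr_wpDr ?powR_ge0.
have Qu : 0 < p + `|u| `^ q by rewrite ltr_wpDr ?powR_ge0.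
have lnE v : 1 + `|v| `^ q / p = (p + `|v| `^ q) / p.
  by rewrite mulrDl divff ?gt_eqF.
rewrite /hpq !lnE -ln_div ?posrE ?divr_gt0 //.
(* Prepares [ln (1 + r) <= r], which leaves a bound linear in the q-th power of [|u|]. *)
have -> : (p + `|u| `^ q) / p / ((p + `|t| `^ q) / p) =
    1 + (`|u| `^ q - `|t| `^ q) / (p + `|t| `^ q).
  by field; rewrite !gt_eqF.
apply: le_trans (le_ln1Dx _) _.
  rewrite ltr_pdivlMr // mulN1r ltrBrDr; lra.
have sq v : `|v| `^ q = (v ^+ 2) `^ (q / 2).
  by rewrite -real_normK ?num_real // -powR_mulrn // -powRrM mulrC divfK.
have t20 : 0 < t ^+ 2 by rewrite exprn_even_gt0.
have P0 : 0 < `|t| `^ q by exact: powR_gt0.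
(* Bernoulli with exponent [q / 2] at the point [u^2 / t^2]. *)
have bern : `|u| `^ q <= `|t| `^ q * (1 - q / 2 + q / 2 * (u ^+ 2 / t ^+ 2)).
  have -> : `|u| `^ q = `|t| `^ q * (u ^+ 2 / t ^+ 2) `^ (q / 2).
    rewrite !sq -powRM ?sqr_ge0 ?divr_ge0 ?sqr_ge0 //; congr (_ `^ _).
    by rewrite mulrC divfK ?gt_eqF.
  rewrite ler_wpM2l ?powR_ge0 // powR_bernoulli ?divr_ge0 ?sqr_ge0 //.
  by apply/andP; split; lra.
rewrite /hweight powRB ?normr_eq0 ?t0 ?implybT // powR_mulrn //.
rewrite real_normK ?num_real //.
have -> : (u ^+ 2 - t ^+ 2) / (2 * (t ^+ 2 / `|t| `^ q * (p + `|t| `^ q) / q)) =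
    (`|t| `^ q * (1 - q / 2 + q / 2 * (u ^+ 2 / t ^+ 2)) - `|t| `^ q) /
    (p + `|t| `^ q).
  by field; rewrite t0 !gt_eqF.
by rewrite ler_pM2r ?invr_gt0 // lerD2r.
Qed.

(** Covers [t = 0] too: then [u = 0] and both sides are 0. *)
Lemma hpq_tangent_supp (R : realType) (p q t u : R) :
  0 < p -> 0 < q -> q <= 1 -> (t = 0 -> u = 0) ->
  hpq p q u - hpq p q t <= (u ^+ 2 - t ^+ 2) / hweight p q t / 2.
Proof.
move=> p0 q0 q1; have [-> ->//|t0 _] := eqVneq t 0.
  by rewrite !subrr !mul0r.
by rewrite -mulrA -invfM [hweight _ _ _ * 2]mulrC hpq_tangent.
Qed.

Lemma hweight_ge0 (R : realType) (p q t : R) :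
  0 < p -> 0 < q -> 0 <= hweight p q t.
Proof.
by move=> p0 q0; rewrite divr_ge0 ?mulr_ge0 ?addr_ge0 ?powR_ge0 ?ltW.
Qed.

Lemma hweight_eq0 (R : realType) (p q t : R) :
  0 < p -> 0 < q -> hweight p q t = 0 -> t = 0.
Proof.
move=> p0 q0 w0; apply: contra_eq w0 => t0.
by rewrite gt_eqF // hweight_gt0.
Qed.

Lemma reweighted_stepE (R : realType) (m n : nat) (p q : R)
    (A : 'M[R]_(m, n)) (b : 'cV[R]_m) (x : 'cV[R]_n) :
  reweighted_step p q A b x =
  weighted_solution (\row_j hweight p q (x j 0)) A b.
Proof. by []. Qed.

(** * Continuity and limits *)

Lemma continuous_norm_powR (R : realType) (a : R) :
  0 < a -> continuous (fun t : R => `|t| `^ a).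
Proof.
move=> a0 t; have [->|t0] := eqVneq t 0.
  apply/cvgrPdist_lt => e e0; rewrite normr0 powR0 ?gt_eqF//.
  near=> s; rewrite sub0r normrN ger0_norm ?powR_ge0 //.
  (* Writing [e] as the a-th power of its a-th root shows that this root is a suitable radius. *)
  rewrite -[ltRHS]powRr1 ?ltW // -(mulVf (lt0r_neq0 a0)) powRrM.
  rewrite gt0_ltr_powR ?nnegrE ?powR_ge0 //; near: s.
  exists (e `^ a^-1) => /=; first exact: powR_gt0.
  by move=> x; rewrite /ball_ /= sub0r normrN.
apply: (@continuous_cvg R R R (nbhs t) _ Num.norm (fun s : R => s `^ a) `|t|);
  last exact: norm_continuous.
apply/differentiable_continuous/derivable1_diffP/derivable_powR.
by rewrite in_itv /= andbT normr_gt0.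
Unshelve. all: by end_near. Qed.

Lemma continuous_hweight (R : realType) (p q : R) :
  0 < q -> q <= 1 -> continuous (hweight p q).
Proof.
move=> q0 q1 t; apply: cvgM; last exact: cvg_cst.
apply: cvgM; first by apply: continuous_norm_powR; lra.
by apply: cvgD; [exact: cvg_cst | exact: continuous_norm_powR].
Qed.

Lemma cvg_finsum (R : realType) (n : nat) (T : Type) (F : set_system T)
    (f : 'I_n -> T -> R) (l : 'I_n -> R) : Filter F ->
  (forall i, f i u @[u --> F] --> l i) ->
  \sum_i f i u @[u --> F] --> \sum_i l i.
Proof. by move=> FF fl; apply: cvg_big => //; exact: add_continuous. Qed.

Lemma norm_hpq_ge0 (R : realType) (n : nat) (p q : R) (x : 'cV[R]_n) :
  0 < p -> 0 <= norm_hpq p q x.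
Proof.
move=> p0; apply: sumr_ge0 => i _.
by rewrite ln_ge0 // lerDl divr_ge0 ?powR_ge0 ?ltW.
Qed.

(** The tail from [N] on is monotone and bounded below, so [u] and its shift have the same limit.
    The offset [N] is there because [x 0] is unconstrained. *)
Lemma cvg_nonincreasing_gap (R : realType) (u : nat -> R) (N : nat) :
  (forall k, (N <= k)%N -> u k.+1 <= u k) -> (forall k, 0 <= u k) ->
  u k - u k.+1 @[k --> \oo] --> 0.
Proof.
move=> u_decr u_ge0; pose v k := u (k + N)%N.
have v_cvg : cvgn v.
  apply: nonincreasing_is_cvgn; last by exists 0 => _ [k _ <-]; exact: u_ge0.
  by apply/nonincreasing_seqP => k; rewrite /v addSn u_decr ?leq_addl.
have u_lim : u @ \oo --> limn v.
  by move: v_cvg; rewrite [X in X -> _](@cvg_shiftn N R u).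
rewrite -[X in _ --> X](subrr (limn v)); apply: cvgB => //.
by move: u_lim; rewrite -[X in X -> _](@cvg_shiftS R u).
Qed.

(** * Descent and limit points of the reweighted step *)

Section Step.
Variables (R : realType) (m n : nat) (p q : R) (A : 'M[R]_(m, n)).
Variables (b : 'cV[R]_m).
Hypotheses (p0 : 0 < p) (q0 : 0 < q) (q1 : q <= 1).

Let d (x : 'cV[R]_n) : 'rV[R]_n := \row_j hweight p q (x j 0).

Let d_ge0 x j : 0 <= d x 0 j.
Proof. by rewrite mxE hweight_ge0. Qed.

Let supp_d x j : d x 0 j = 0 -> x j 0 = 0.
Proof. by rewrite mxE; exact: hweight_eq0. Qed.

Lemma reweighted_step_feasible x : A *m x = b ->
  A *m reweighted_step p q A b x = b.
Proof.
by move=> <-; exact: (weighted_solution_feasible A (d_ge0 x) (@supp_d x)).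
Qed.

(** The tangent bounds, summed over the coordinates, leave a difference of quadratic forms, which
    Pythagoras turns into a squared distance. The 2 clears the factor 1/2 in the slope. *)
Lemma reweighted_step_descent x (y := reweighted_step p q A b x) : A *m x = b ->
  \sum_j (x j 0 - y j 0) ^+ 2 / hweight p q (x j 0) <=
  2 * (norm_hpq p q x - norm_hpq p q y).
Proof.
move=> Axb; have := weighted_solution_pythagoras A (d_ge0 x) (@supp_d x).
rewrite Axb -reweighted_stepE -/y => pyth.
have -> : \sum_j (x j 0 - y j 0) ^+ 2 / hweight p q (x j 0) =
    \sum_j (x j 0 - y j 0) ^+ 2 / d x 0 j.
  by apply: eq_bigr => j _; rewrite [d _ _ _]mxE.
rewrite -pyth -sumrB mulr_sumr ler_sum // => j _; rewrite [d _ _ _]mxE.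
have yj0 : x j 0 = 0 -> y j 0 = 0.
  move=> xj0; rewrite /y reweighted_stepE weighted_solution_supp //.
  by rewrite mxE xj0 hweight0.
have := hpq_tangent_supp p0 q0 q1 yj0; rewrite ler_pdivlMr // => tangent.
have := mulNr (x j 0 ^+ 2 - y j 0 ^+ 2) (hweight p q (x j 0))^-1.
rewrite opprB; lra.
Qed.

(** The filter [G] plays the part of a subsequence converging to [xs]. *)
Lemma reweighted_step_fixpoint (G : set_system 'cV[R]_n) (xs : 'cV[R]_n) :
  ProperFilter G -> G --> xs -> (\forall u \near G, A *m u = b) ->
  norm_hpq p q u - norm_hpq p q (reweighted_step p q A b u) @[u --> G] --> 0 ->
  xs = reweighted_step p q A b xs.
Proof.
move=> FG Gxs GA gap0; pose T := reweighted_step p q A b.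
have Gcoord j : (u : 'cV[R]_n) j 0 @[u --> G] --> xs j 0.
  exact: (cvg_comp _ _ Gxs (@coord_continuous R n 1 j 0 xs)).
have Gw j :
    hweight p q ((u : 'cV[R]_n) j 0) @[u --> G] --> hweight p q (xs j 0).
  exact: (cvg_comp _ _ (Gcoord j) (@continuous_hweight R p q q0 q1 (xs j 0))).
have GT j : T u j 0 @[u --> G] --> xs j 0.
  suff T0 : (u : 'cV[R]_n) j 0 - T u j 0 @[u --> G] --> 0.
    have -> : (fun u => T u j 0) =
        (fun u : 'cV[R]_n => u j 0 - (u j 0 - T u j 0)).
      by apply/funext => u; rewrite subKr.
    by rewrite -[X in _ --> X]subr0; exact: cvgB.
  apply/norm_cvg0P.
  have -> : (fun u : 'cV[R]_n => `|u j 0 - T u j 0|) =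
      (fun u : 'cV[R]_n => Num.sqrt ((u j 0 - T u j 0) ^+ 2)).
    by apply/funext => u; rewrite sqrtr_sqr.
  rewrite -[X in _ --> X](@sqrtr0 R).
  apply: continuous_cvg; first exact: sqrt_continuous.
  (* One term of the descent sum bounds the squared coordinate difference by [B u]; the weight
     factor converges and the gap tends to 0. *)
  pose B (u : 'cV[R]_n) :=
    hweight p q (u j 0) * (2 * (norm_hpq p q u - norm_hpq p q (T u))).
  have B0 : B u @[u --> G] --> 0.
    rewrite -[X in _ --> X](mulr0 (hweight p q (xs j 0))).
    rewrite -[X in _ * X](mulr0 2).
    by apply: cvgM => //; apply: cvgM => //; exact: cvg_cst.
  apply: (squeeze_cvgr _ (cvg_cst 0) B0).
  near=> u; rewrite sqr_ge0 /=.
  have Au : A *m u = b by near: u.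
  have desc := reweighted_step_descent Au.
  have [w0|w0] := eqVneq (hweight p q (u j 0)) 0.
    rewrite /B w0 mul0r /T reweighted_stepE weighted_solution_supp ?mxE //.
    by rewrite (hweight_eq0 p0 q0 w0) subrr expr0n.
  rewrite /B mulrC -ler_pdivrMr ?lt_def ?w0 ?hweight_ge0 //.
  apply: le_trans desc; rewrite (bigD1 j) //= lerDl sumr_ge0 // => i _.
  by rewrite divr_ge0 ?sqr_ge0 ?hweight_ge0.
have Axs : A *m xs = b.
  apply/colP => i; rewrite mxE.
  have lim : \sum_j A i j * (u : 'cV[R]_n) j 0 @[u --> G] -->
      \sum_j A i j * xs j 0.
    by apply: cvg_finsum => j; apply: cvgM => //; exact: cvg_cst.
  have cst : \sum_j A i j * (u : 'cV[R]_n) j 0 @[u --> G] --> b i 0.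
    apply: cvg_near_cst; near=> u.
    have <- : A *m u = b by near: u.
    by rewrite mxE.
  exact: norm_cvg_unique lim cst.
rewrite reweighted_stepE -Axs.
apply: weighted_solution_unique (d_ge0 xs) (@supp_d xs) _ => z supp_z Az0.
have Gorth : \forall u \near G,
    \sum_j T u j 0 * z j 0 / hweight p q (u j 0) = 0.
  (* Nonzero coordinates of [xs] stay nonzero nearby, so [z] is eventually an admissible test vector
     for [u] as well. *)
  have Gsupp :
      \forall u \near G, forall j, z j 0 != 0 -> (u : 'cV[R]_n) j 0 != 0.
    suff Gsupp j : \forall u \near G, z j 0 != 0 -> (u : 'cV[R]_n) j 0 != 0.
      exact: filter_forall Gsupp.
    have [_|zj0] := eqVneq (z j 0) 0; first by near=> u.
    have xj0 : xs j 0 != 0.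
      by apply: contra_neq zj0 => xj0; apply: supp_z; rewrite mxE xj0 hweight0.
    by near=> u => _; near: u; exact: cvgr_neq0 (Gcoord j) xj0.
  near=> u.
  have supp_u : forall j, z j 0 != 0 -> u j 0 != 0 by near: u.
  rewrite -[RHS](@weighted_solution_orthogonal R m n (d u) A b z) //.
    by apply: eq_bigr => j _; rewrite [d _ _ _]mxE.
  move=> j /supp_d uj0; apply/eqP; apply: contraT => /supp_u.
  by rewrite uj0 eqxx.
have lim : \sum_j T u j 0 * z j 0 / hweight p q (u j 0) @[u --> G] -->
    \sum_j xs j 0 * z j 0 / d xs 0 j.
  (* Where [z j 0 = 0] the inverse weight may blow up, but the term is identically 0; elsewhere the
     limit weight is nonzero. *)
  apply: cvg_finsum => j; have [zj0|zj0] := eqVneq (z j 0) 0.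
    rewrite zj0 mulr0 mul0r; apply: cvg_near_cst; near=> u.
    by rewrite mulr0 mul0r.
  apply: cvgM; first by apply: cvgM => //; exact: cvg_cst.
  rewrite [d _ _ _]mxE; apply: cvgV => //.
  by apply: contra_neq zj0 => w0; apply: supp_z; rewrite mxE.
have cst : \sum_j T u j 0 * z j 0 / hweight p q (u j 0) @[u --> G] --> 0.
  exact: cvg_near_cst.
exact: norm_cvg_unique lim cst.
Unshelve. all: by end_near. Qed.

End Step.

Theorem theorem7 (R : realType) (m n : nat) (A : 'M[R]_(m, n)) (b : 'cV[R]_m)
    (p q : R) (x : nat -> 'cV[R]_n) :
  (exists y : 'cV[R]_n, A *m y = b) ->
  0 < p -> 0 < q -> q <= 1 ->
  l1_solution A b (x 1%N) ->
  (forall k : nat, (1 <= k)%N -> x k.+1 = reweighted_step p q A b (x k)) ->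
  (forall k : nat, (1 <= k)%N -> norm_hpq p q (x k.+1) <= norm_hpq p q (x k)) /\
  (forall xstar : 'cV[R]_n, cluster (x @ \oo) xstar ->
    xstar = reweighted_step p q A b xstar).
Proof.
move=> _ p0 q0 q1 [Ax1 _] step.
have Ax k : (1 <= k)%N -> A *m x k = b.
  case: k => // k _; elim: k => [//|k IHk].
  by rewrite step // reweighted_step_feasible.
have decr k : (1 <= k)%N -> norm_hpq p q (x k.+1) <= norm_hpq p q (x k).
  move=> k1; rewrite step // -subr_ge0 -(pmulr_rge0 _ (ltr0Sn R 1)).
  apply: le_trans (reweighted_step_descent p0 q0 q1 (Ax k k1)).
  by apply: sumr_ge0 => j _; rewrite divr_ge0 ?sqr_ge0 ?hweight_ge0.
(* A cluster point is the limit of a proper filter [G] that contains every property holding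
   eventually along [x]. *)
split=> // xs; rewrite cluster_cvgE => -[G FG [Gxs subG]].
have evG (P : set 'cV[R]_n) : (\forall k \near \oo, P (x k)) -> G P.
  exact: subG.
apply: (reweighted_step_fixpoint p0 q0 q1 FG Gxs).
  by apply: evG; exists 1%N.
have gap0 := cvg_nonincreasing_gap decr (fun k => norm_hpq_ge0 q (x k) p0).
move=> B /gap0 gapB; apply: evG; near=> k.
(* The recursion starts at index 1, hence the restriction to large [k]. *)
rewrite /= -step; last by near: k; exact: nbhs_infty_ge.
by near: k.
Unshelve. all: by end_near. Qed.
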